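(* Let $\epsilon\in\mathbb C$ with $\epsilon\ne0$ and $\epsilon^{-1}\notin\mathbb Z$, and let $\mathcal A$ be the graded mirror Heisenberg-Virasoro left-symmetric algebra with parameter $\epsilon$. Then any biderivation $f$ of $\mathcal A$ is trivial, i.e. $f=0$.
   Context: The graded mirror Heisenberg-Virasoro left-symmetric algebra $\mathcal A$ (with parameter $\epsilon\in\mathbb C$, $\epsilon\neq0$, $\epsilon^{-1}\notin\mathbb Z$) is the complex algebra with basis $\{d_n,\ h_{n+\frac12},\ \mathbf c,\ \mathbf l\mid n\in\mathbb Z\}$ and bilinear product given, for all $m,n\in\mathbb Z$, by $$d_m d_n=-\frac{n(1+\epsilon n)}{1+\epsilon(m+n)}\,d_{m+n}+\frac1{24}\big(m^3-m+(\epsilon-\epsilon^{-1})m^2\big)\delta_{m+n,0}\,\mathbf c,$$ $$d_m h_{n+\frac12}=-\Big(n+\tfrac12\Big)h_{m+n+\frac12},\qquad h_{m+\frac12}h_{n+\frac12}=\tfrac12\Big(m+\tfrac12\Big)\delta_{m+n+1,0}\,\mathbf l,$$ all other products of basis elements being zero. A biderivation of an algebra $\mathcal A$ with product $xy$ is a bilinear map $f:\mathcal A\times\mathcal A\to\mathcal A$ that is a derivation in each argument: for all $x,y,z\in\mathcal A$, $f(xy,z)=f(x,z)\,y+x\,f(y,z)$ and $f(x,yz)=f(x,y)\,z+y\,f(x,z)$. *)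

(* Defs.v *)
From HB Require Import structures.
From mathcomp Require Import all_boot all_order all_algebra.
From mathcomp Require Import finmap monalg.
From mathcomp Require Import reals.
From mathcomp Require Import complex.

Set Implicit Arguments.
Unset Strict Implicit.
Unset Printing Implicit Defensive.

Import GRing.Theory.
Local Open Scope ring_scope.

(* [bH n] stands for h_(n + 1/2). *)
Inductive mhv_basis := bD of int | bH of int | bC | bL.

Definition mhv_basis_code (b : mhv_basis) : int + int + bool :=
  match b with
  | bD n => inl (inl n)
  | bH n => inl (inr n)
  | bC => inr true
  | bL => inr false
  end.

Definition mhv_basis_decode (s : int + int + bool) : mhv_basis :=
  match s with
  | inl (inl n) => bD n
  | inl (inr n) => bH n
  | inr true => bC
  | inr false => bL
  end.

Lemma mhv_basis_codeK : cancel mhv_basis_code mhv_basis_decode.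
Proof. by case. Qed.

HB.instance Definition _ := Choice.copy mhv_basis (can_type mhv_basis_codeK).

(* The bilinear extension to the free K-module on B of a product table [m]. *)
Definition bilin_ext (K : comNzRingType) (B : choiceType)
    (m : B -> B -> {malg K[B]}) (x y : {malg K[B]}) : {malg K[B]} :=
  \sum_(i <- msupp x) \sum_(j <- msupp y) (x@_i * y@_j) *: m i j.

Lemma bilin_extE (K : comNzRingType) (B : choiceType)
    (m : B -> B -> {malg K[B]}) (x y : {malg K[B]}) (D E : {fset B}) :
  (msupp x `<=` D)%fset -> (msupp y `<=` E)%fset ->
  bilin_ext m x y = \sum_(i <- D) \sum_(j <- E) (x@_i * y@_j) *: m i j.
Proof.
move=> sD sE; rewrite /bilin_ext [LHS](big_fset_incl _ sD) /=; last first.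
  move=> i _ /mcoeff_outdom xi0.
  by rewrite big1 // => j _; rewrite xi0 mul0r scale0r.
apply: eq_bigr => i _; rewrite [LHS](big_fset_incl _ sE) //= => j _.
by move=> /mcoeff_outdom yj0; rewrite yj0 mulr0 scale0r.
Qed.

Lemma bilin_ext_basis (K : comNzRingType) (B : choiceType)
    (m : B -> B -> {malg K[B]}) (i j : B) :
  bilin_ext m << i >> << j >> = m i j.
Proof.
rewrite (@bilin_extE _ _ _ _ _ [fset i]%fset [fset j]%fset) ?msuppU_le //.
by rewrite !big_seq_fset1 !mcoeffUU mulr1 scale1r.
Qed.

Lemma bilin_ext_bilinear (K : comNzRingType) (B : choiceType)
    (m : B -> B -> {malg K[B]}) :
  bilinear_for *:%R *:%R (bilin_ext m).
Proof.
split=> [z|z] a x y /=.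
- pose D := (msupp x `|` msupp y `|` msupp (a *: x + y))%fset.
  have sx : (msupp x `<=` D)%fset by rewrite /D -fsetUA fsubsetUl.
  have sy : (msupp y `<=` D)%fset by rewrite /D fsetUAC fsubsetUr.
  have sxy : (msupp (a *: x + y) `<=` D)%fset by rewrite fsubsetUr.
  rewrite (bilin_extE _ sx (fsubset_refl _)) (bilin_extE _ sy (fsubset_refl _)).
  rewrite (bilin_extE _ sxy (fsubset_refl _)) scaler_sumr -big_split /=.
  apply: eq_bigr => i _; rewrite scaler_sumr -big_split /=.
  apply: eq_bigr => j _.
  by rewrite scalerA -scalerDl mcoeffD mcoeffZ mulrDl mulrA.
- pose D := (msupp x `|` msupp y `|` msupp (a *: x + y))%fset.
  have sx : (msupp x `<=` D)%fset by rewrite /D -fsetUA fsubsetUl.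
  have sy : (msupp y `<=` D)%fset by rewrite /D fsetUAC fsubsetUr.
  have sxy : (msupp (a *: x + y) `<=` D)%fset by rewrite fsubsetUr.
  rewrite (bilin_extE _ (fsubset_refl _) sx) (bilin_extE _ (fsubset_refl _) sy).
  rewrite (bilin_extE _ (fsubset_refl _) sxy) scaler_sumr -big_split /=.
  apply: eq_bigr => i _; rewrite scaler_sumr -big_split /=.
  apply: eq_bigr => j _.
  by rewrite scalerA -scalerDl mcoeffD mcoeffZ mulrDr mulrCA.
Qed.

(* The complex numbers are R[i], for R any model of the real numbers. *)
Notation mhv R := {malg R[i][mhv_basis]}.

Definition mhv_basis_mul (R : realType) (eps : R[i]) (x y : mhv_basis) : mhv R :=
  match x, y with
  | bD m, bD n =>
      - (n%:~R * (1 + eps * n%:~R) / (1 + eps * (m + n)%:~R)) *: << bD (m + n) >>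
      + (24%:R^-1 * (m%:~R ^+ 3 - m%:~R + (eps - eps^-1) * m%:~R ^+ 2)
         * (m + n == 0)%:R) *: << bC >>
  | bD m, bH n => - (n%:~R + 2%:R^-1) *: << bH (m + n) >>
  | bH m, bH n =>
      (2%:R^-1 * (m%:~R + 2%:R^-1) * (m + n + 1 == 0)%:R) *: << bL >>
  | _, _ => 0
  end.

Definition mhv_mul (R : realType) (eps : R[i]) : mhv R -> mhv R -> mhv R :=
  bilin_ext (mhv_basis_mul eps).

HB.instance Definition _ (R : realType) (eps : R[i]) :=
  bilinear_isBilinear.Build R[i] (mhv R) (mhv R) (mhv R) *:%R *:%R
    (mhv_mul eps) (bilin_ext_bilinear (mhv_basis_mul eps)).

(* A is a possibly nonassociative K-algebra with product [mul]. *)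
Definition biderivation (K : comNzRingType) (A : lmodType K)
    (mul : A -> A -> A) (f : {bilinear A -> A -> A}) : Prop :=
  (forall x y z, f (mul x y) z = mul (f x z) y + mul x (f y z)) /\
  (forall x y z, f x (mul y z) = mul (f x y) z + mul y (f x z)).

(* Main.v *)
Require Import Defs.
From HB Require Import structures.
From mathcomp Require Import all_boot all_order all_algebra.
From mathcomp Require Import finmap monalg.
From mathcomp Require Import reals.
From mathcomp Require Import complex.
From mathcomp Require Import ring zify.

Import GRing.Theory Num.Theory.
Local Open Scope ring_scope.

(** Left multiplication by [d_0] is diagonal in the given basis: it multiplies
    [d_n] by [- n], [h_(n+1/2)] by [- (n + 1/2)], and kills [c] and [l].  So the
    algebra is graded by a weight, and [d_0] detects that grading.  Right
    multiplication by [d_0] is zero.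

    Every derivation [D] preserves weights ([derivation_graded]).  Indeed
    [0 = D (d_0 d_0) = (D d_0) d_0 + d_0 (D d_0) = d_0 (D d_0)], so [D d_0] has weight 0.  For [x] of weight
    [w], [D (d_0 x) = (D d_0) x + d_0 (D x)] then compares [- w (D x)] with
    [d_0 (D x)] up to a term of weight [w]; in a weight [k <> w] this reads
    [(k - w) (D x)_k = 0].

    A biderivation [f] is a derivation in each argument, so [f x z] has both the
    weight of [x] and the weight of [z]: it vanishes on basis vectors of distinct
    weights ([bider_neq_weight]).  When the weights agree, the Leibniz rule in
    the first argument reduces to the former case, because [f (x y) z] vanishes
    as soon as [x] and [y] have weights other than that of [z] ([bider_prod]),
    and basis vectors are combinations of such products:
    [d_n] (for [n <> 0]) is a multiple of [d_(-n) d_(2n)], [h_(n+1/2)] of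
    [d_1 h_(n-1/2)] and [l] of [h_(1/2) h_(-1/2)], while [d_0] and [c] lie in
    the span of [d_1 d_(-1)] and [d_(-1) d_1].  The assumptions on [eps] ensure
    that the scalars occurring there do not vanish. *)

(** * Linear and bilinear maps on free modules *)

Section Bilinear.
Context {K : comNzRingType} {B : choiceType} {U V : lmodType K}.

Lemma linear_malgE (D : {linear {malg K[B]} -> V}) (x : {malg K[B]}) :
  D x = \sum_(i <- msupp x) x@_i *: D << i >>.
Proof.
rewrite {1}[x]monalgE linear_sum; apply: eq_bigr => i _.
rewrite -linearZ_LR; congr (D _).
by apply/malgP => k; rewrite mcoeffZ !mcoeffU mulrnAr mulr1.
Qed.

Lemma bilinear_malglE (f : {bilinear {malg K[B]} -> U -> V}) (x : {malg K[B]}) (y : U) :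
  f x y = \sum_(i <- msupp x) x@_i *: f << i >> y.
Proof. exact: (linear_malgE (applyr f y)). Qed.

Lemma bilinear_malgrE (f : {bilinear U -> {malg K[B]} -> V}) (x : U) (y : {malg K[B]}) :
  f x y = \sum_(j <- msupp y) y@_j *: f x << j >>.
Proof. exact: linear_malgE. Qed.

Lemma bilinear_lin_combl {W : lmodType K} (f : {bilinear W -> U -> V})
    (a b : K) (u v : W) (y : U) :
  f (a *: u + b *: v) y = a *: f u y + b *: f v y.
Proof. by rewrite linearDl 2!linearZl_LR. Qed.

End Bilinear.

(** The product of the algebra is an instance of [bilin_ext]; the expansions are
    stated over an abstract ring, where finding the bilinear structure does not
    unfold the complex numbers. *)
Section BilinExt.
Variables (K : comNzRingType) (B : choiceType) (m : B -> B -> {malg K[B]}).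

HB.instance Definition _ :=
  bilinear_isBilinear.Build K {malg K[B]} {malg K[B]} {malg K[B]} *:%R *:%R
    (bilin_ext m) (bilin_ext_bilinear m).

Lemma bilin_ext_malglE (x y : {malg K[B]}) :
  bilin_ext m x y = \sum_(i <- msupp x) x@_i *: bilin_ext m << i >> y.
Proof. exact: bilinear_malglE. Qed.

Lemma bilin_ext_malgrE (x y : {malg K[B]}) :
  bilin_ext m x y = \sum_(j <- msupp y) y@_j *: bilin_ext m x << j >>.
Proof. exact: bilinear_malgrE. Qed.

End BilinExt.

(** Identifies the scalars of two combinations of given vectors, where a plain
    congruence step would have to find the module structure again. *)
Lemma lin_comb_congr {K : nzRingType} {V : lmodType K} (a b c d : K) (u v : V) :
  a = c -> b = d -> a *: u + b *: v = c *: u + d *: v.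
Proof. by move=> -> ->. Qed.

Lemma lin_comb_eq0 {K : fieldType} {V : lmodType K} (a b c : K) (u v : V) :
  a != b -> c != 0 -> a *: u + c *: v = 0 -> b *: u + c *: v = 0 ->
  u = 0 /\ v = 0.
Proof.
move=> ab c0 ea eb.
have u0 : u = 0.
  have : (a - b) *: u = 0.
    by rewrite scalerBl -[LHS]addr0 -{1}(subrr (c *: v)) addrACA -opprD ea eb subrr.
  by move/eqP; rewrite scaler_eq0 subr_eq0 (negPf ab) => /eqP.
split=> //; move/eqP: ea.
by rewrite u0 scaler0 add0r scaler_eq0 (negPf c0) => /eqP.
Qed.

(** * Derivations preserve the weight *)

Definition derivation {K : comNzRingType} {A : lmodType K}
    (mul : A -> A -> A) (D : A -> A) : Prop :=
  forall x y, D (mul x y) = mul (D x) y + mul x (D y).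

(** Twice the eigenvalue of minus the left multiplication by [d_0]: the factor 2
    keeps the weights of the [h_(n+1/2)] integral. *)
Definition weight (b : mhv_basis) : int :=
  match b with
  | bD n => 2 * n
  | bH n => 2 * n + 1
  | bC | bL => 0
  end.

Section MHV.
Variables (R : realType) (eps : R[i]).
Hypotheses (eps_neq0 : eps <> 0) (epsV_nint : forall k : int, eps^-1 <> k%:~R).

Lemma eps_denom_neq0 (n : int) : 1 + eps * n%:~R != 0.
Proof.
apply/eqP => e0; apply: (epsV_nint (- n)).
have eps0 : eps != 0 by apply/eqP.
apply: (mulfI eps0); rewrite mulfV // rmorphN /= mulrN.
by apply/eqP; rewrite -addr_eq0 e0.
Qed.

Lemma half_int_neq0 (n : int) : n%:~R + 2%:R^-1 != 0 :> R[i].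
Proof.
have two0 : 2%:R != 0 :> R[i] by rewrite pnatr_eq0.
apply/eqP => n0; have /eqP : (2 * n + 1)%:~R = 0 :> R[i].
  by rewrite rmorphD rmorphM /= -(mul0r 2%:R) -n0; field.
by rewrite intr_eq0; lia.
Qed.

Lemma mhv_mul_d0_basis (j : mhv_basis) :
  mhv_mul eps << bD 0 >> << j >>
  = - ((weight j)%:~R / 2%:R) *: << j >> :> mhv R.
Proof.
have two0 : 2%:R != 0 :> R[i] by rewrite pnatr_eq0.
rewrite /mhv_mul bilin_ext_basis; case: j => [n|n||] /=.
- have -> : 24%:R^-1 * (0%:~R ^+ 3 - 0%:~R + (eps - eps^-1) * 0%:~R ^+ 2)
            * (0 + n == 0)%:R = 0 :> R[i] by rewrite mulr0z; ring.
  rewrite scale0r addr0 add0r -mulrA (divff (eps_denom_neq0 n)) mulr1.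
  by congr (- _ *: _); rewrite rmorphM /=; field.
- by rewrite add0r; congr (- _ *: _); rewrite rmorphD rmorphM /=; field.
- by rewrite mul0r oppr0 scale0r.
- by rewrite mul0r oppr0 scale0r.
Qed.

Lemma mhv_mul_d0l (y : mhv R) (b : mhv_basis) :
  (mhv_mul eps << bD 0 >> y)@_b = - ((weight b)%:~R / 2%:R) * y@_b.
Proof.
rewrite [mhv_mul _ _ _]bilin_ext_malgrE (raddf_sum (mcoeff b)).
rewrite [y in RHS]monalgE raddf_sum mulr_sumr /=.
apply: eq_bigr => j _.
rewrite -/(mhv_mul _ _ _) mhv_mul_d0_basis !mcoeffZ !mcoeffU.
by case: eqP => [->|_]; rewrite ?mulr0 // mulr1n mulr1 mulrC.
Qed.

Lemma mhv_mul_d0r (x : mhv R) : mhv_mul eps x << bD 0 >> = 0.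
Proof.
rewrite [mhv_mul _ _ _]bilin_ext_malglE big1 // => i _ /=.
rewrite /mhv_mul bilin_ext_basis; case: i => [m|n||] /=; rewrite ?scaler0 //.
rewrite mulr0z !mul0r oppr0 scale0r add0r addr0.
by case: eqP => [->|_];
  rewrite ?mulr0z ?expr0n /= ?mulr0 ?subrr ?addr0 ?mulr0 ?mul0r scale0r scaler0.
Qed.

Lemma mhv_mul_graded (i j b : mhv_basis) :
  weight b != weight i + weight j -> (mhv_mul eps << i >> << j >>)@_b = 0.
Proof.
rewrite /mhv_mul bilin_ext_basis => wb.
have off k : weight k = weight i + weight j -> (k == b) = false.
  by move=> wk; apply/negP => /eqP kb; rewrite -wk kb eqxx in wb.
case: i j off {wb} => [m|m||] [n|n||] off /=; rewrite ?mcoeff0 //.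
(* Only the support of the product matters, so its scalars are generalized. *)
- rewrite mcoeffD; move: (- _) (24%:R^-1 * _) => a c.
  rewrite [X in X + _]mcoeffZ [X in _ + X]mcoeffZ 2!mcoeffU.
  rewrite off; last by rewrite /weight; lia.
  rewrite mulr0 add0r.
  case: (eqVneq (m + n) 0) => mn; last by rewrite mulr0 mul0r.
  by rewrite off ?mulr0 // /weight; lia.
- rewrite mcoeffZ mcoeffU; move: (- _) => a.
  by rewrite off ?mulr0 // /weight; lia.
- rewrite mcoeffZ mcoeffU; move: (2%:R^-1 * _) => a.
  case: (eqVneq (m + n + 1) 0) => mn; last by rewrite mulr0 mul0r.
  by rewrite off ?mulr0 // /weight; lia.
Qed.

(** [D d_0] has weight 0, hence so does the operator of left multiplication by
    [D d_0]; the Leibniz rule for [d_0 j] then says that, outside the weight of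
    [j], the vector [D j] is an eigenvector of [d_0] for the eigenvalue of [j]
    itself, which forces it to be 0 there. *)
Lemma derivation_graded (D : {linear mhv R -> mhv R}) (j b : mhv_basis) :
  derivation (mhv_mul eps) D -> weight b != weight j -> (D << j >>)@_b = 0.
Proof.
move=> derD wb.
have two0 : 2%:R != 0 :> R[i] by rewrite pnatr_eq0.
have Dd0 i : weight i != 0 -> (D << bD 0 >>)@_i = 0.
  move=> wi; have := derD << bD 0 >> << bD 0 >>.
  rewrite !mhv_mul_d0r linear0 add0r => /(congr1 (mcoeff i)) /esym /eqP.
  rewrite mcoeff0 mhv_mul_d0l mulf_eq0 oppr_eq0 mulf_eq0 invr_eq0 (negPf two0).
  by rewrite orbF intr_eq0 (negPf wi) => /eqP.
have Dd0j : (mhv_mul eps (D << bD 0 >>) << j >>)@_b = 0.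
  rewrite [mhv_mul _ _ _]bilin_ext_malglE.
  rewrite (raddf_sum (mcoeff b)) big1 // => i _ /=.
  rewrite -/(mhv_mul _ _ _) mcoeffZ; case: (eqVneq (weight i) 0) => [wi|/Dd0 ->].
    by rewrite mhv_mul_graded ?mulr0 // wi add0r.
  by rewrite mul0r.
have := derD << bD 0 >> << j >>; rewrite mhv_mul_d0_basis linearZ_LR /=.
move=> /(congr1 (mcoeff b)); rewrite [LHS]mcoeffZ [RHS]mcoeffD.
rewrite [X in X + _]Dd0j [X in _ + X]mhv_mul_d0l add0r.
move: (_@_b) => u; move/eqP; rewrite -subr_eq0 -mulrBl mulf_eq0 => /orP[|/eqP //].
rewrite opprK addrC -mulrBl mulf_eq0 invr_eq0 (negPf two0) orbF -rmorphB /=.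
by rewrite intr_eq0 subr_eq0 (negPf wb).
Qed.

(** * Vanishing of biderivations *)

Variable f : {bilinear mhv R -> mhv R -> mhv R}.
Hypothesis f_bider : biderivation (mhv_mul eps) f.

(** [f i j] is the value at [i] of the derivation [f _ j] and the value at [j] of
    the derivation [f i _], so a basis vector in its support has both weights. *)
Lemma bider_neq_weight (i j : mhv_basis) :
  weight i != weight j -> f << i >> << j >> = 0.
Proof.
move=> wij; apply/malgP => b; rewrite mcoeff0.
case: (eqVneq (weight b) (weight j)) => wb.
  apply: (@derivation_graded (applyr f << j >>)); last by rewrite wb eq_sym.
  by move=> x y; apply: (proj1 f_bider).
by apply: (@derivation_graded (f << i >>)) => // x y; apply: (proj2 f_bider).
Qed.

Lemma bider_prod (i j z : mhv_basis) :
  weight i != weight z -> weight j != weight z ->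
  f (mhv_basis_mul eps i j) << z >> = 0.
Proof.
move=> wi wj; rewrite -bilin_ext_basis -/(mhv_mul eps _ _) (proj1 f_bider).
by rewrite !bider_neq_weight // linear0l linear0r addr0.
Qed.

Lemma bider_scale_eq0 (a : R[i]) (x z : mhv R) : a != 0 -> f (a *: x) z = 0 -> f x z = 0.
Proof.
move=> a0; rewrite linearZl_LR /= => /eqP.
by rewrite scaler_eq0 (negPf a0) => /eqP.
Qed.

(** The two products below differ in their [d_0] coefficients and agree in their
    nonzero [c] coefficient, so together they span [d_0] and [c]. *)
Lemma mul_d1_dN1 :
  mhv_basis_mul eps (bD 1) (bD (- 1)) =
  (1 - eps) *: << bD 0 >> + ((eps - eps^-1) / 24%:R) *: << bC >>.
Proof.
rewrite /mhv_basis_mul -[(1 - 1 : int)]/(0 : int).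
apply: lin_comb_congr.
  by rewrite mulr0z (mulr0 eps) (addr0 1) divr1; ring.
by rewrite eqxx mulr1n; ring.
Qed.

Lemma mul_dN1_d1 :
  mhv_basis_mul eps (bD (- 1)) (bD 1) =
  - (1 + eps) *: << bD 0 >> + ((eps - eps^-1) / 24%:R) *: << bC >>.
Proof.
rewrite /mhv_basis_mul -[(- 1 + 1 : int)]/(0 : int).
apply: lin_comb_congr.
  by rewrite mulr0z (mulr0 eps) (addr0 1) divr1; ring.
by rewrite eqxx mulr1n; ring.
Qed.

Lemma bider_d0_c (z : mhv_basis) : weight z = 0 ->
  f << bD 0 >> << z >> = 0 /\ f << bC >> << z >> = 0.
Proof.
move=> wz.
have two0 : 2%:R != 0 :> R[i] by rewrite pnatr_eq0.
have eps0 : eps != 0 by apply/eqP.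
have := bider_prod (bD 1) (bD (- 1)) z; have := bider_prod (bD (- 1)) (bD 1) z.
rewrite wz mul_d1_dN1 mul_dN1_d1 => /(_ isT isT) p /(_ isT isT) q.
rewrite bilinear_lin_combl in p; rewrite bilinear_lin_combl in q.
apply: lin_comb_eq0 p q.
  rewrite -subr_eq0.
  have -> : - (1 + eps) - (1 - eps) = - 2%:R by ring.
  by rewrite oppr_eq0.
(* [eps = eps^-1] would mean [eps = 1] or [eps = -1], against the integrality
   hypothesis on [eps^-1]. *)
have -> : (eps - eps^-1) / 24%:R =
    - ((1 + eps * 1%:~R) * (1 + eps * (- 1)%:~R)) / (eps * 24%:R).
  by field; rewrite eps0.
by rewrite !(mulf_neq0, oppr_eq0, invr_eq0) ?eps_denom_neq0 // pnatr_eq0.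
Qed.

(** A basis vector [i] of the same weight as [j] is obtained from products of
    basis vectors of other weights, to which [bider_prod] applies. *)
Lemma bider_basis (i j : mhv_basis) : f << i >> << j >> = 0.
Proof.
case: (eqVneq (weight i) (weight j)) => [|/bider_neq_weight //].
case: i => [n|n||] wi.
- case: (eqVneq n 0) => [n0|n0].
    by rewrite n0 in wi *; case: (bider_d0_c j).
  (* [d_(-n) d_(2n)] is a multiple of [d_n] by a scalar with factors [2n] and
     [1 + 2 n eps], and [-n] and [2n] both differ from [n]. *)
  have := bider_prod (bD (- n)) (bD (2 * n)) j.
  rewrite -wi /mhv_basis_mul.
  have -> : - n + 2 * n = n by lia.
  have -> : (n == 0) = false by lia.
  rewrite mulr0n mulr0 scale0r addr0 /weight => p.
  apply: bider_scale_eq0 (p _ _); try lia.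
  rewrite oppr_eq0 mulf_neq0 ?invr_eq0 ?eps_denom_neq0 //.
  rewrite mulf_neq0 ?eps_denom_neq0 // intr_eq0; lia.
- have := bider_prod (bD 1) (bH (n - 1)) j; rewrite -wi /mhv_basis_mul.
  have -> : 1 + (n - 1) = n by lia.
  rewrite /weight => p.
  by apply: bider_scale_eq0 (p _ _); rewrite ?oppr_eq0 ?half_int_neq0 //; lia.
- by case: (bider_d0_c j).
- have := bider_prod (bH 0) (bH (- 1)) j; rewrite -wi /mhv_basis_mul => /(_ isT isT).
  apply: bider_scale_eq0.
  have -> : (0 + - 1 + 1 == 0 :> int) = true by [].
  by rewrite mulr1 mulf_neq0 ?half_int_neq0 // invr_eq0 pnatr_eq0.
Qed.

End MHV.

Theorem theorem20 (R : realType) (eps : R[i])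
  (eps_neq0 : eps <> 0)
  (epsV_nint : forall k : int, eps^-1 <> k%:~R)
  (f : {bilinear mhv R -> mhv R -> mhv R})
  (f_bider : biderivation (mhv_mul eps) f) :
  forall x y : mhv R, f x y = 0.
Proof.
move=> x y; rewrite bilinear_malgrE big1 // => j _.
rewrite bilinear_malglE big1 ?scaler0 // => i _.
by rewrite (bider_basis _ _ _ _ _ f_bider) // scaler0.
Qed.
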